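(* For any weight function $\mathbf L:W\to\mathbb N$ there exists a canonical basis $\mathfrak B^{\imath\jmath}_{n,d}=\{\{A\}^{\mathbf L}:A\in\Xi^{\imath\jmath}\}$ of $\mathbb S^{\imath\jmath,\mathbf L}$ such that for all $A\in\Xi^{\imath\jmath}$ $$\overline{\{A\}^{\mathbf L}}=\{A\}^{\mathbf L},\qquad\{A\}^{\mathbf L}\in[A]^{\mathbf L}+\sum_{B\in\Xi^{\imath\jmath},\,B<_{\mathrm{alg}}A}\boldsymbol v^{-c}\,\mathbb Z[\boldsymbol v^{-c}]\,[B]^{\mathbf L},$$ where $c=\gcd(|\mathbf L(s_0)-\mathbf L(s_d)|,\ \mathbf L(s_0)+\mathbf L(s_d),\ \mathbf L(s_1))$. Moreover, $\mathfrak B^{\imath\jmath}_{n,d}=\mathfrak B^{\mathfrak c}_{n,d}\cap\mathbb S^{\imath\jmath,\mathbf L}$, where $\mathfrak B^{\mathfrak c}_{n,d}$ is the canonical basis of $\mathbb S^{\mathfrak c,\mathbf L}_{n,d}$. Here $\Xi^{\imath\jmath}=\{A\in\Xi_{n,d}:\mathrm{row}_{\mathfrak c}(A)_{0}=0=\mathrm{col}_{\mathfrak c}(A)_{0}\}$ and $\mathbb S^{\imath\jmath}=\mathrm{End}_{\mathbb H}\big(\bigoplus_{\lambda\in\Lambda,\ \lambda_{0}=0}x_\lambda\mathbb H\big)\subset\mathbb S^{\mathfrak c}_{n,d}$.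
   Context: **Weyl group.** Fix integers $r\ge 0$, $d\ge 2$; $n=2r+2$, $D=2d+2$, $\mathbb N=\{0,1,\dots\}$. $W$ is the group of permutations $g$ of $\mathbb Z$ with $g(i+D)=g(i)+D$, $g(-i)=-g(i)$ (affine Weyl group of type $\widetilde C_d$). Let $(i,j)_{\mathfrak c}$ swap $kD+i\leftrightarrow kD+j$ and $kD-i\leftrightarrow kD-j$ for all $k$ and fix other integers; Coxeter generators: $s_0=(1,-1)_{\mathfrak c}$, $s_i=(i,i+1)_{\mathfrak c}$ ($1\le i\le d-1$), $s_d=(d,d+2)_{\mathfrak c}$; $\ell$ is the length. $\Lambda$ is the set of $\lambda=(\lambda_0,\dots,\lambda_{r+1})\in\mathbb N^{r+2}$ with sum $d$; $\lambda_{0,i}=\lambda_0+\cdots+\lambda_i$; $W_\lambda$ is generated by $\{s_0,\dots,s_d\}\setminus\{s_{\lambda_0},s_{\lambda_{0,1}},\dots,s_{\lambda_{0,r}}\}$; $\mathscr D_\lambda=\{g:\ell(wg)=\ell(w)+\ell(g)\ \forall w\in W_\lambda\}$; $\mathscr D_{\lambda\mu}=\mathscr D_\lambda\cap\mathscr D_\mu^{-1}$. $R^\lambda_0=[-\lambda_0..\lambda_0]$, $R^\lambda_i=[\lambda_{0,i-1}+1..\lambda_{0,i}]$ ($1\le i\le r$), $R^\lambda_{r+1}=[d+1-\lambda_{r+1}..d+1+\lambda_{r+1}]$, $R^\lambda_{-i}=-R^\lambda_i$, $R^\lambda_{i+n}=R^\lambda_i+D$. **Matrices.** $\Xi_{n,d}$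 is the set of $\mathbb Z\times\mathbb Z$ matrices $A=(a_{ij})$ over $\mathbb N$ with $a_{-i,-j}=a_{ij}=a_{i+n,j+n}$, $a_{00},a_{r+1,r+1}$ odd, $\sum_{i=1}^n\sum_ja_{ij}=D$. $a'_{ii}=\frac12(a_{ii}-1)$ if $i\equiv0,r+1\pmod n$, $a'_{ij}=a_{ij}$ otherwise. $\mathrm{row}_{\mathfrak c}(A)$ has entries (indices $0$; $1\le k\le r$; $r+1$) $a'_{00}+\sum_{j\ge1}a_{0j}$; $\sum_ja_{kj}$; $a'_{r+1,r+1}+\sum_{j\le r}a_{r+1,j}$; $\mathrm{col}_{\mathfrak c}(A)=\mathrm{row}_{\mathfrak c}(A^{\mathrm{transpose}})$. Bijection $\kappa:\bigsqcup_{\lambda,\mu\in\Lambda}\{\lambda\}\times\mathscr D_{\lambda\mu}\times\{\mu\}\to\Xi_{n,d}$, $\kappa(\lambda,g,\mu)=(|R^\lambda_i\cap gR^\mu_j|)$. $A\le_{\mathrm{alg}}B$ iff $\mathrm{row}_{\mathfrak c}(A)=\mathrm{row}_{\mathfrak c}(B)$, $\mathrm{col}_{\mathfrak c}(A)=\mathrm{col}_{\mathfrak c}(B)$ and $\sum_{x\le i,y\ge j}a_{xy}\le\sum_{x\le i,y\ge j}b_{xy}$ for all $i<j$; $<_{\mathrm{alg}}$ is the strict version. **Hecke and Schur algebras.** $\mathbb A=\mathbb Z[q^{\pm1/2},q_0^{\pm1/2},q_1^{\pm1/2}]$; $\mathbb H$ is the $\mathbb A$-algebra generated by $T_0,\dots,T_d$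 with the braid relations of $W$ and $(T_0-q_0^{-1})(T_0+q_1)=0$, $(T_i-q^{-1})(T_i+q)=0$ ($1\le i\le d-1$), $(T_d-q_1^{-1})(T_d+q_0^{-1})=0$. $T_w$, $q_w$ are multiplicative along reduced words, $q_{s_0}=q_1$, $q_{s_i}=q$ ($1\le i\le d-1$), $q_{s_d}=q_0^{-1}$. $T_X=\sum_{w\in X}q_w^{-1}T_w$, $x_\lambda=T_{W_\lambda}$. $\mathbb S^{\mathfrak c}_{n,d}=\mathrm{End}_{\mathbb H}(\bigoplus_{\lambda\in\Lambda}x_\lambda\mathbb H)$ has $\mathbb A$-basis $e_A$ ($A=\kappa(\lambda,g,\mu)$), $e_A(x_\nu)=\delta_{\mu\nu}T_{W_\lambda gW_\mu}$. Standard basis: $[A]=q_0^{\frac12(\hat\ell_{\mathfrak c_0}(A)-\hat\ell_{\mathfrak c_d}(A))}q_1^{\frac12(\hat\ell_{\mathfrak c_0}(A)+\hat\ell_{\mathfrak c_d}(A))}q^{\hat\ell_{\mathfrak a}(A)}e_A$, where $\hat\ell_{\mathfrak c_0}(A)=\frac12(\sum_{x\le0,y>0}+\sum_{x\ge0,y<0})a_{xy}$, $\hat\ell_{\mathfrak c_d}(A)=\frac12(\sum_{x\le r+1,y>r+1}+\sum_{x\ge r+1,y<r+1})a_{xy}$, $\hat\ell_{\mathfrak a}(A)=\frac12\sum_{(i,j)\in I^+}(\sum_{x\le i,y>j}+\sum_{x\ge i,y<j})a''_{ij}a_{xy}$, $I^+=(\{0\}\times\mathbb N)\sqcup([1..r]\times\mathbb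 Z)\sqcup(\{r+1\}\times\mathbb Z_{\le r+1})$, $a''_{ii}=\frac12(a_{ii}-3)$ for $i=0,r+1$, $a''_{ij}=a_{ij}$ otherwise. $\mathbb S^{\imath\jmath}$ is naturally a (non-unital) subalgebra with basis $\{[A]:A\in\Xi^{\imath\jmath}\}$. **Bar involution.** On $\mathbb H$: inverts $q^{1/2},q_0^{1/2},q_1^{1/2}$, $\overline{T_w}=T_{w^{-1}}^{-1}$. On $\mathbb S^{\mathfrak c}_{n,d}$: $\overline f(x_\mu)=\overline{f(\overline{x_\mu})}$ for $f\in\mathrm{Hom}_{\mathbb H}(x_\mu\mathbb H,x_\lambda\mathbb H)$. **Specialization.** A weight function $\mathbf L:W\to\mathbb N$ satisfies $\mathbf L(ww')=\mathbf L(w)+\mathbf L(w')$ whenever $\ell(ww')=\ell(w)+\ell(w')$. A superscript $\mathbf L$ denotes base change to $\mathbb Z[\boldsymbol v^{\pm1/2}]$ along $q\mapsto\boldsymbol v^{-\mathbf L(s_1)}$, $q_0\mapsto\boldsymbol v^{-\mathbf L(s_0)+\mathbf L(s_d)}$, $q_1\mapsto\boldsymbol v^{-\mathbf L(s_0)-\mathbf L(s_d)}$ (and square roots), with bar $\boldsymbol v^{1/2}\mapsto\boldsymbol v^{-1/2}$. The canonical basis $\mathfrak B^{\mathfrak c}_{n,d}=\{\{A\}^{\mathbf L}:A\in\Xi_{n,d}\}$ of $\mathbb S^{\mathfrak c,\mathbf L}_{n,d}$ is characterized by consisting of bar-invariant elements with $\{A\}^{\mathbf L}\in[A]^{\mathbf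 L}+\sum_{B\in\Xi_{n,d},\,B<_{\mathrm{alg}}A}\boldsymbol v^{-c}\mathbb Z[\boldsymbol v^{-c}][B]^{\mathbf L}$, with the same $c$.
   Formalization: For some L no such basis exists with this c (e.g. r=d=2, L(s_0)=L(s_d)=1, L(s_1)=2, c=2, where a coefficient v^{-1} is forced); the formal theorem therefore takes as a premise that the canonical basis B^c of S^{c,L}, with the same c, exists. *)

(* Defs.v *)
From HB Require Import structures.
From mathcomp Require Import all_boot all_order all_algebra.
From mathcomp Require Import finmap.
From mathcomp Require Import boolp classical_sets functions cardinality fsbigop.
From mathcomp Require Import monalg.
From mathcomp Require Import zify ring.

Set Implicit Arguments.
Unset Strict Implicit.
Unset Printing Implicit Defensive.

Import Order.TTheory GRing.Theory Num.Theory.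
Local Open Scope classical_set_scope.
Local Open Scope quotient_scope.
Local Open Scope ring_scope.

(* Group rings Z[G].  Z[Z^3] and Z[Z] are the rings of Laurent polynomials in *)
(* three variables and in one variable; [mono k] is the monomial with         *)
(* exponent k.  ({malg int[G]} has no ring structure in the library, because  *)
(* a monomType has no invertible element except 1.)                           *)
Definition gring (G : zmodType) : Type := {malg int[G]}.

HB.instance Definition _ (G : zmodType) :=
  GRing.Zmodule.copy (gring G) {malg int[G]}.

Section GroupRing.
Variable G : zmodType.
Implicit Types (g h : gring G) (k : G).

Definition mono k : gring G := << 1 *g k >>.

Definition gext (V : zmodType) (F : G -> V) g : V :=
  \sum_(k <- msupp g) F k *~ g@_k.

Lemma gextEw (V : zmodType) (F : G -> V) g (D : {fset G}) :
  (msupp g `<=` D)%fset -> gext F g = \sum_(k <- D) F k *~ g@_k.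
Proof.
move=> sD; rewrite /gext (big_fset_incl _ sD) //= => k _ /mcoeff_outdom ->.
by rewrite mulr0z.
Qed.

Lemma gextD (V : zmodType) (F : G -> V) : {morph gext F : g h / g + h}.
Proof.
move=> g h; pose D := (msupp g `|` msupp h)%fset.
rewrite (@gextEw _ F g D) ?fsubsetUl // (@gextEw _ F h D) ?fsubsetUr //.
rewrite (@gextEw _ F (g + h) D); last exact: msuppD_le.
rewrite -big_split /=; apply: eq_bigr => k _.
by rewrite (mcoeffD k g h) mulrzDr.
Qed.

Lemma gext_mono (V : zmodType) (F : G -> V) k : gext F (mono k) = F k.
Proof.
rewrite (@gextEw _ F _ [fset k]%fset) ?big_seq_fset1 ?mcoeffUU ?mulr1z //.
exact: msuppU_le.
Qed.

Lemma gext_is_zmod (V : zmodType) (F : G -> V) : zmod_morphism (gext F).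
Proof.
have e0 : gext F 0 = 0.
  by apply: (addrI (gext F 0)); rewrite -gextD !addr0.
have eN g : gext F (- g) = - gext F g.
  by apply: (addrI (gext F g)); rewrite -gextD !subrr.
by move=> g h; rewrite gextD eN.
Qed.

HB.instance Definition _ (V : zmodType) (F : G -> V) :=
  GRing.isZmodMorphism.Build (gring G) V (gext F) (gext_is_zmod F).

Lemma eq_gext (V : zmodType) (F F' : G -> V) : F =1 F' -> gext F =1 gext F'.
Proof. by move=> eF g; apply: eq_bigr => k _; rewrite eF. Qed.

Lemma gringE g : g = \sum_(k <- msupp g) mono k *~ g@_k.
Proof.
rewrite [LHS]monalgE; apply: eq_bigr => k _.
rewrite /mono -[in LHS](intz g@_k).
by rewrite -(raddfMz (mkmalgU k)).
Qed.

Lemma gring_eq (V : zmodType) (f f' : {additive gring G -> V}) :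
  (forall k, f (mono k) = f' (mono k)) -> f =1 f'.
Proof.
move=> ff' g; rewrite (gringE g) !raddf_sum; apply: eq_bigr => k _.
by rewrite !raddfMz ff'.
Qed.

End GroupRing.

Section GroupRingMul.
Variable G : zmodType.
Implicit Types (f g h : gring G) (k l : G).

Definition gmul f g : gring G :=
  gext (fun k => gext (fun l => mono (k + l)) g) f.
Definition gmull g f := gmul f g.

HB.instance Definition _ g := GRing.isZmodMorphism.Build (gring G) (gring G)
  (gmull g) (gext_is_zmod (fun k => gext (fun l => mono (k + l)) g)).

Lemma gmul_monol k g : gmul (mono k) g = gext (fun l => mono (k + l)) g.
Proof. exact: gext_mono. Qed.

Lemma gmul_mono k l : gmul (mono k) (mono l) = mono (k + l).
Proof. by rewrite gmul_monol gext_mono. Qed.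

Lemma gmul_zmod f : zmod_morphism (gmul f).
Proof.
move=> g h; pose F h k := gext (fun l => mono (k + l)) h.
rewrite -[LHS]/(\sum_(k <- msupp f) F (g - h) k *~ f@_k).
rewrite -[RHS]/(\sum_(k <- msupp f) F g k *~ f@_k -
                \sum_(k <- msupp f) F h k *~ f@_k).
by rewrite -sumrB; apply: eq_bigr => k _; rewrite /F gext_is_zmod mulrzBl.
Qed.

HB.instance Definition _ f := GRing.isZmodMorphism.Build (gring G) (gring G)
  (gmul f) (gmul_zmod f).

Lemma gmulC : commutative gmul.
Proof.
move=> f g; apply: (gring_eq (f := gmull g) (f' := gmul g)) => k.
rewrite /= /gmull gmul_monol; apply: eq_gext => l.
by rewrite gext_mono addrC.
Qed.

Lemma gmulA : associative gmul.
Proof.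
move=> f g h.
apply: (gring_eq (f := gmull (gmul g h)) (f' := gmull h \o gmull g)) => k /=.
apply: (gring_eq (f := gmul (mono k) \o gmull h)
                 (f' := gmull h \o gmul (mono k))) => l /=.
apply: (gring_eq (f := gmul (mono k) \o gmul (mono l))
                 (f' := gmul (gmul (mono k) (mono l)))) => m /=.
by rewrite !gmul_mono addrA.
Qed.

Lemma gmul1 : left_id (mono 0) gmul.
Proof.
move=> g; apply: (gring_eq (f := gmul (mono 0)) (f' := idfun)) => k /=.
by rewrite gmul_mono add0r.
Qed.

Lemma gmulDl : left_distributive gmul +%R.
Proof. by move=> f g h; apply: (raddfD (gmull h)). Qed.

Lemma gone_neq0 : mono 0 != 0 :> gring G.
Proof. by rewrite /mono monalgU_eq0. Qed.

HB.instance Definition _ := GRing.Zmodule_isComNzRing.Build (gring G)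
  gmulA gmulC gmul1 gmulDl gone_neq0.

Lemma monoD k l : mono (k + l) = mono k * mono l.
Proof. by rewrite [RHS]gmul_mono. Qed.

End GroupRingMul.

Section GroupRingMap.
Variables (G G' : zmodType) (u : {additive G -> G'}).

Definition gmap : gring G -> gring G' := gext (fun k => mono (u k)).

HB.instance Definition _ := GRing.isZmodMorphism.Build (gring G) (gring G')
  gmap (gext_is_zmod (fun k => mono (u k))).

Lemma gmap_mono k : gmap (mono k) = mono (u k).
Proof. exact: gext_mono. Qed.

Lemma gmap_is_monoid : monoid_morphism gmap.
Proof.
split=> [|f g]; first by rewrite gmap_mono raddf0.
apply: (gring_eq (f := gmap \o gmull g) (f' := gmull (gmap g) \o gmap)) => k /=.
apply: (gring_eq (f := gmap \o gmul (mono k))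
                 (f' := gmul (gmap (mono k)) \o gmap)) => l /=.
by rewrite gmul_mono !gmap_mono gmul_mono raddfD.
Qed.

HB.instance Definition _ := GRing.isMonoidMorphism.Build (gring G) (gring G')
  gmap gmap_is_monoid.

End GroupRingMap.

Inductive spanned (R : pzRingType) (V : lmodType R) (S : set V) : V -> Prop :=
| spanned0 : spanned S 0
| spannedZD a x y : S x -> spanned S y -> spanned S (a *: x + y).

(* The quotient of a module by the submodule spanned by [S].                  *)
Section QuotientModule.
Variables (R : pzRingType) (V : lmodType R) (S : set V).

Lemma spannedD x y : spanned S x -> spanned S y -> spanned S (x + y).
Proof.
by elim=> [|a u v Su _ IH] Sy; rewrite ?add0r // -addrA; constructor; auto.
Qed.

Lemma spannedZ a x : spanned S x -> spanned S (a *: x).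
Proof.
elim=> [|b u v Su _ IH]; first by rewrite scaler0; constructor.
by rewrite scalerDr scalerA; constructor.
Qed.

Definition span_pred : {pred V} := fun x => `[< spanned S x >].

Lemma span_zmod : zmod_closed span_pred.
Proof.
split=> [|x y /asboolP Sx /asboolP Sy]; apply/asboolP; first by constructor.
by rewrite -scaleN1r; apply/spannedD/spannedZ.
Qed.

HB.instance Definition _ := GRing.isZmodClosed.Build V span_pred span_zmod.

Definition quotmod : Type := {ideal_quot span_pred}.
HB.instance Definition _ := GRing.Zmodule.on quotmod.
HB.instance Definition _ := EqQuotient.on quotmod.

Definition piq (x : V) : quotmod := \pi x.

Lemma piqP x y : piq x = piq y <-> spanned S (x - y).
Proof.
split=> [/eqP|Sxy].
  by rewrite eqmodE => /asboolP.
by apply/eqP; rewrite eqmodE; apply/asboolP.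
Qed.

Lemma piq_zmod : zmod_morphism piq.
Proof. exact: pi_is_zmod_morphism. Qed.

HB.instance Definition _ := GRing.isZmodMorphism.Build V quotmod piq piq_zmod.

Lemma piqK (x : quotmod) : piq (repr x) = x.
Proof. exact: reprK. Qed.

Lemma piq_ind (P : quotmod -> Prop) : (forall x, P (piq x)) -> forall x, P x.
Proof. by move=> PP x; rewrite -(piqK x). Qed.

Definition quot_scale (a : R) (x : quotmod) : quotmod := piq (a *: repr x).

Lemma quot_scaleE a x : quot_scale a (piq x) = piq (a *: x).
Proof. by apply/piqP; rewrite -scalerBr; apply/spannedZ/piqP; rewrite piqK. Qed.

Lemma quot_scaleA a b x : quot_scale a (quot_scale b x) = quot_scale (a * b) x.
Proof. by elim/piq_ind: x => x; rewrite !quot_scaleE scalerA. Qed.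

Lemma quot_scale1 : left_id 1 quot_scale.
Proof. by elim/piq_ind=> x; rewrite quot_scaleE scale1r. Qed.

Lemma quot_scaleDr : right_distributive quot_scale +%R.
Proof.
move=> a; elim/piq_ind=> x; elim/piq_ind=> y.
by rewrite -(raddfD piq) !quot_scaleE -(raddfD piq) scalerDr.
Qed.

Lemma quot_scaleDl x : {morph quot_scale^~ x : a b / a + b}.
Proof.
by move=> a b; elim/piq_ind: x => x; rewrite !quot_scaleE -(raddfD piq) scalerDl.
Qed.

HB.instance Definition _ := GRing.Zmodule_isLmodule.Build R quotmod
  quot_scaleA quot_scale1 quot_scaleDr quot_scaleDl.

Lemma piq_scalable : scalable piq.
Proof. by move=> a x; apply/esym/quot_scaleE. Qed.

HB.instance Definition _ := GRing.isScalable.Build R V quotmod *:%R piq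
  piq_scalable.

End QuotientModule.

(* The quotient of an algebra by the two-sided ideal generated by [S].  It is *)
(* not declared as an [algType] because that would require 1 != 0.            *)
Section QuotientAlgebra.
Variables (R : comNzRingType) (V : algType R) (S : set V).

Definition ideal_gens : set V :=
  [set x | exists u s v, S s /\ x = u * s * v].

Definition quotalg : Type := quotmod ideal_gens.
HB.instance Definition _ := GRing.Lmodule.on quotalg.

Definition pia (x : V) : quotalg := piq ideal_gens x.

Lemma spannedMl u x : spanned ideal_gens x -> spanned ideal_gens (u * x).
Proof.
elim=> [|a _ y [v [s [w [Ss ->]]]] _ IH]; first by rewrite mulr0; constructor.
rewrite mulrDr -scalerAr; constructor=> //.
by exists (u * v), s, w; rewrite !mulrA.
Qed.

Lemma spannedMr u x : spanned ideal_gens x -> spanned ideal_gens (x * u).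
Proof.
elim=> [|a _ y [v [s [w [Ss ->]]]] _ IH]; first by rewrite mul0r; constructor.
rewrite mulrDl -scalerAl; constructor=> //.
by exists v, s, (w * u); rewrite !mulrA.
Qed.

Lemma piaD x y : pia (x + y) = pia x + pia y.
Proof. exact: (raddfD (piq ideal_gens)). Qed.

Lemma piaZ a x : pia (a *: x) = a *: pia x.
Proof. exact: piq_scalable. Qed.

Definition quot_mul (x y : quotalg) : quotalg := pia (repr x * repr y).

Lemma quot_mulE x y : quot_mul (pia x) (pia y) = pia (x * y).
Proof.
apply/piqP; set x' := repr _; set y' := repr _.
have -> : x' * y' - x * y = (x' - x) * y' + x * (y' - y).
  by rewrite mulrBl mulrBr addrA subrK.
by apply: spannedD; [apply: spannedMr|apply: spannedMl]; apply/piqP;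
  rewrite piqK.
Qed.

Lemma pia_ind (P : quotalg -> Prop) : (forall x, P (pia x)) -> forall x, P x.
Proof. exact: piq_ind. Qed.

Lemma quot_mulA : associative quot_mul.
Proof.
by elim/pia_ind=> x; elim/pia_ind=> y; elim/pia_ind=> z; rewrite !quot_mulE mulrA.
Qed.

Lemma quot_mul1l : left_id (pia 1) quot_mul.
Proof. by elim/pia_ind=> x; rewrite quot_mulE mul1r. Qed.

Lemma quot_mul1r : right_id (pia 1) quot_mul.
Proof. by elim/pia_ind=> x; rewrite quot_mulE mulr1. Qed.

Lemma quot_mulDl : left_distributive quot_mul +%R.
Proof.
elim/pia_ind=> x; elim/pia_ind=> y; elim/pia_ind=> z.
by rewrite -piaD !quot_mulE mulrDl piaD.
Qed.

Lemma quot_mulDr : right_distributive quot_mul +%R.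
Proof.
elim/pia_ind=> x; elim/pia_ind=> y; elim/pia_ind=> z.
by rewrite -piaD !quot_mulE mulrDr piaD.
Qed.

HB.instance Definition _ := GRing.Zmodule_isPzRing.Build quotalg
  quot_mulA quot_mul1l quot_mul1r quot_mulDl quot_mulDr.

Lemma piaM x y : pia (x * y) = pia x * pia y.
Proof. exact/esym/quot_mulE. Qed.

Lemma quot_scalerAl (a : R) (x y : quotalg) : a *: (x * y) = a *: x * y.
Proof.
elim/pia_ind: x => x; elim/pia_ind: y => y.
by rewrite -(piaM x y) -!piaZ -piaM scalerAl.
Qed.

Lemma quot_scalerAr (a : R) (x y : quotalg) : a *: (x * y) = x * (a *: y).
Proof.
elim/pia_ind: x => x; elim/pia_ind: y => y.
by rewrite -(piaM x y) -!piaZ -piaM scalerAr.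
Qed.

End QuotientAlgebra.

(* The base change B (x)_A M along phi : A -> B, as the quotient of the free  *)
(* B-module on M by the bilinearity relations.                                *)
Section BaseChange.
Variables (A B : comNzRingType) (phi : {rmorphism A -> B}) (M : lmodType A).

Definition tens_rel : set {malg B[M]} :=
  [set x | (exists m m', x = << m + m' >> - << m >> - << m' >>) \/
           (exists a m, x = << a *: m >> - phi a *: << m >>)].

Definition bchange : Type := quotmod tens_rel.
HB.instance Definition _ := GRing.Lmodule.on bchange.

Definition tens (b : B) (m : M) : bchange := piq tens_rel (b *: << m >>).

End BaseChange.

(* D = perD d and n = perN r.                                                 *)
Definition perD (d : nat) : int := (d.*2.+2)%:Z.
Definition perN (r : nat) : int := (r.*2.+2)%:Z.

Section Weyl.
Variable d : nat.
Implicit Types (f : int -> int) (i j x : int).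

Definition is_weyl f : Prop :=
  [/\ bijective f, forall x, f (x + perD d) = f x + perD d
                 & forall x, f (- x) = - f x].

Record weyl : Type := Weyl { wact :> int -> int; _ : `[< is_weyl wact >] }.

HB.instance Definition _ := [isSub for wact].
HB.instance Definition _ := [Choice of weyl by <:].

Lemma weylP (w : weyl) : is_weyl w.
Proof. by case: w => f /= /asboolP. Qed.

Lemma weyl_eq (v w : weyl) : v =1 w -> v = w.
Proof. by move=> vw; apply/val_inj/funext. Qed.

Lemma is_weyl1 : is_weyl id.
Proof. by split=> //; exists id. Qed.

Lemma is_weylM (v w : weyl) : is_weyl (v \o w).
Proof.
have [bv Dv Nv] := weylP v; have [bw Dw Nw] := weylP w.
by split=> [|x|x] /=; [apply: bij_comp|rewrite Dw Dv|rewrite Nw Nv].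
Qed.

Definition finv f (y : int) : int := xget 0 [set x | f x = y].

Lemma finvK f : bijective f -> cancel (finv f) f /\ cancel f (finv f).
Proof.
move=> bf; have K y : f (finv f y) = y.
  by have [g _ gK] := bf; apply: (xgetI (P := [set x | f x = y]) 0 (gK y)).
by split=> // x; apply: (bij_inj bf); rewrite K.
Qed.

Lemma is_weylV (w : weyl) : is_weyl (finv w).
Proof.
have [bw Dw Nw] := weylP w; have [K1 K2] := finvK bw.
split=> [|x|x]; first by exists w.
  by apply: (can_inj K2); rewrite Dw !K1.
by apply: (can_inj K2); rewrite Nw !K1.
Qed.

Definition weyl1 : weyl := Weyl (asboolT is_weyl1).
Definition weylM v w : weyl := Weyl (asboolT (is_weylM v w)).
Definition weylV w : weyl := Weyl (asboolT (is_weylV w)).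

Lemma weylMA : associative weylM.
Proof. by move=> u v w; apply: weyl_eq. Qed.
Lemma weylM1l : left_id weyl1 weylM.
Proof. by move=> u; apply: weyl_eq. Qed.
Lemma weylM1r : right_id weyl1 weylM.
Proof. by move=> u; apply: weyl_eq. Qed.
Lemma weylMVl : left_inverse weyl1 weylV weylM.
Proof.
move=> w; apply: weyl_eq => x /=; have [bw _ _] := weylP w.
by rewrite (finvK bw).2.
Qed.
Lemma weylMVr : right_inverse weyl1 weylV weylM.
Proof.
move=> w; apply: weyl_eq => x /=; have [bw _ _] := weylP w.
by rewrite (finvK bw).1.
Qed.

HB.instance Definition _ := isGroup.Build weyl
  weylMA weylM1l weylM1r weylMVl weylMVr.

Definition eqD x i : bool := (perD d %| x - i)%Z.

(* (i,j)_c : both i -> j and -j -> -i are shifts by j - i.                    *)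
Definition cswap i j x : int :=
  if eqD x i || eqD x (- j) then x + (j - i)
  else if eqD x j || eqD x (- i) then x - (j - i)
  else x.

Definition sgen_act (k : 'I_d.+1) : int -> int :=
  if k == 0%N :> nat then cswap 1 (- 1)
  else if k == d :> nat then cswap d (d%:Z + 2)
  else cswap k (k%:Z + 1).

(* The generators s_k; see [sgenE] below for 0 < d.                           *)
Definition sgen (k : 'I_d.+1) : weyl := insubd (1%g : weyl) (sgen_act k).

Section Swap.
Variables i j : int.
Hypotheses (ij : ~~ eqD i j) (i2 : ~~ eqD (i + i) 0) (j2 : ~~ eqD (j + j) 0).

Lemma dvdD_eq (a b c : int) : (perD d %| a)%Z -> (perD d %| b)%Z ->
  c = a - b -> (perD d %| c)%Z.
Proof. by move=> Da Db ->; apply: rpredB. Qed.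

Lemma cswapK : involutive (cswap i j).
Proof.
move=> x; rewrite {2}/cswap.
case: ifP => [h|/negbT]; last rewrite negb_or => /andP[n1 n2].
  rewrite /cswap ifF; last first.
    apply/negbTE; rewrite negb_or; apply/andP; split; apply/negP => h'.
      case/orP: h => h; [move: ij|move: i2]; apply/negP; rewrite negbK.
        by apply: (dvdD_eq h h'); ring.
      by apply: (dvdD_eq h h'); ring.
    case/orP: h => h; [move: j2|move: ij]; apply/negP; rewrite negbK.
      by apply: (dvdD_eq h' h); ring.
    by apply: (dvdD_eq h h'); ring.
  rewrite ifT ?addrK //; case/orP: h => h; apply/orP; [left|right].
    by rewrite /eqD (_ : _ - _ = x - i) //; ring.
  by rewrite /eqD (_ : _ - _ = x - - j) //; ring.
case: ifP => h; last by rewrite /cswap (negbTE n1) (negbTE n2) h.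
rewrite /cswap ifT ?subrK //; case/orP: h => h; apply/orP; [left|right].
  by rewrite /eqD (_ : _ - _ = x - j) //; ring.
by rewrite /eqD (_ : _ - _ = x - - i) //; ring.
Qed.

Lemma is_weyl_cswap : is_weyl (cswap i j).
Proof.
split=> [|x|x]; first by exists (cswap i j); apply: cswapK.
  have e y : eqD (x + perD d) y = eqD x y.
    rewrite /eqD (_ : x + perD d - y = x - y + perD d); last by ring.
    by rewrite rpredDr // dvdzz.
  by rewrite /cswap !e; case: ifP => _; [ring|case: ifP => _; ring].
have e y : eqD (- x) y = eqD x (- y).
  by rewrite /eqD (_ : - x - y = - (x - - y)) ?rpredN //; ring.
rewrite /cswap !e !opprK [eqD x (- i) || _]orbC [eqD x (- j) || _]orbC.
have [/orP P|_] := boolP (eqD x i || _); last by case: ifP => _ //; ring.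
have [/orP Q|_] := boolP (eqD x j || _); last by ring.
exfalso; case: P => p; case: Q => q.
- by move/negP: ij; apply; apply: (dvdD_eq q p); ring.
- by move/negP: i2; apply; apply: (dvdD_eq q p); ring.
- by move/negP: j2; apply; apply: (dvdD_eq p q); ring.
- by move/negP: ij; apply; apply: (dvdD_eq q p); ring.
Qed.

End Swap.

Lemma sgenE (k : 'I_d.+1) : (0 < d)%N -> sgen k =1 sgen_act k.
Proof.
move=> d0 x; rewrite /sgen insubdK //; apply/asboolP.
have ndvd (z : int) : 0 < `|z| < perD d -> ~~ (perD d %| z)%Z.
  case/andP=> z0 zD; apply/negP; rewrite /dvdz /= => /dvdn_leq.
  by move: zD; rewrite /perD; lia.
have kd := ltn_ord k; have Dd : perD d = d%:Z + d%:Z + 2 by rewrite /perD; lia.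
rewrite /sgen_act; case: eqP => [_|/eqP k0]; last case: eqP => [_|/eqP kd'].
- by apply: is_weyl_cswap; apply: ndvd; rewrite Dd; lia.
- apply: is_weyl_cswap; [apply: ndvd; rewrite Dd; lia..|].
  rewrite /eqD (_ : _ - 0 = 2 + perD d); last by rewrite Dd; lia.
  by rewrite rpredDr ?dvdzz //; apply: ndvd; rewrite Dd; lia.
- by apply: is_weyl_cswap; apply: ndvd; rewrite Dd; lia.
Qed.

End Weyl.

(* Non-commutative polynomials over [R] in the variables [I].                 *)
Definition freealg (R : comNzRingType) (I : choiceType) : Type :=
  {malg R[{fmonom I}]}.

Section FreeAlgebra.
Variables (R : comNzRingType) (I : choiceType).

HB.instance Definition _ :=
  GRing.Lalgebra.copy (freealg R I) {malg R[{fmonom I}]}.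

Lemma freealg_scalerAr (a : R) (x y : freealg R I) :
  a *: (x * y) = x * (a *: y).
Proof.
have C : x * malgC a = malgC a * x.
  apply/malgP => k; rewrite (mcoeffCM a x k) /=.
  rewrite (mcoeffMrw k (fsubset_refl _) (@msuppC_le _ _ a)) big_seq_fset1.
  rewrite [in RHS](monalgE x) raddf_sum mulr_sumr /=; apply: eq_bigr => l _.
  by rewrite mcoeffUU mcoeffU mulm1 mulrnAr mulrC.
by rewrite -(mul_malgC a (x * y)) -(mul_malgC a y) !mulrA C.
Qed.

HB.instance Definition _ := GRing.Lalgebra_isAlgebra.Build R (freealg R I)
  freealg_scalerAr.

Definition fvar (i : I) : freealg R I := << fmu i >>.

End FreeAlgebra.

(* The ring A; the exponent (a, b, c) stands for q^(a/2) q_0^(b/2) q_1^(c/2). *)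
Definition expA : zmodType := (int * int * int)%type.
Definition ringA : comNzRingType := gring expA.

(* From here on, several maps and elements that are determined by a           *)
(* characteristic property are obtained from it with [xget].                  *)
Section Hecke.
Variable d : nat.
Implicit Types (i j : 'I_d.+1) (s t : seq 'I_d.+1) (w : weyl d).

Definition wprod s : weyl d := (\prod_(i <- s) sgen i)%g.

Definition reduced s : Prop :=
  forall t, wprod t = wprod s -> (size s <= size t)%N.

(* Some reduced word of [w]; neither [ell] nor, by Matsumoto's theorem, [TW]  *)
(* and [qexpW] depend on the choice.                                          *)
Definition rword w : seq 'I_d.+1 :=
  xget [::] [set s | wprod s = w /\ reduced s].

Definition ell w : nat := size (rword w).

(* The exponent of q_{s_i}.                                                   *)
Definition qexp i : expA :=
  if i == 0%N :> nat then (0, 0, 2)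
  else if i == d :> nat then (0, - 2, 0)
  else (2, 0, 0).

(* The quadratic relations read (T_i - mono (pexp i)) (T_i + q_{s_i}) = 0.    *)
Definition pexp i : expA :=
  if i == 0%N :> nat then (0, - 2, 0)
  else if i == d :> nat then (0, 0, - 2)
  else (- 2, 0, 0).

(* The order of s_i s_j for i != j, in type C~_d with 2 <= d.                 *)
Definition cox i j : nat :=
  if `|i%:Z - j%:Z|%N == 1%N then
    if [|| i == 0%N :> nat, j == 0%N :> nat, i == d :> nat | j == d :> nat]
    then 4 else 3
  else 2.

Fixpoint alternate i j (m : nat) : seq 'I_d.+1 :=
  if m is m'.+1 then i :: alternate j i m' else [::].

Definition hecke_rel : set (freealg ringA 'I_d.+1) :=
  [set x | (exists i, x = (fvar _ i - (mono (pexp i))%:A)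
                          * (fvar _ i + (mono (qexp i))%:A)) \/
           (exists i j, i != j /\
              x = \prod_(k <- alternate i j (cox i j)) fvar _ k
                  - \prod_(k <- alternate j i (cox i j)) fvar _ k)].

Definition hecke : Type := quotalg hecke_rel.
HB.instance Definition _ := GRing.PzRing.on hecke.
HB.instance Definition _ := GRing.Lmodule.on hecke.

Lemma hecke_scalerAl (a : ringA) (x y : hecke) : a *: (x * y) = a *: x * y.
Proof. exact: quot_scalerAl. Qed.

Lemma hecke_scalerAr (a : ringA) (x y : hecke) : a *: (x * y) = x * (a *: y).
Proof. exact: quot_scalerAr. Qed.

Definition T i : hecke := pia hecke_rel (fvar _ i).

Definition TW w : hecke := \prod_(i <- rword w) T i.

Definition qexpW w : expA := \sum_(i <- rword w) qexp i.

(* T_X = sum_{w in X} q_w^{-1} T_w, for finite X.                             *)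
Definition TX (X : set (weyl d)) : hecke :=
  \sum_(w \in X) mono (- qexpW w) *: TW w.

Definition barA : {rmorphism ringA -> ringA} := gmap (-%R : expA -> expA).

Definition is_barH (b : hecke -> hecke) : Prop :=
  [/\ forall x y, b (x + y) = b x + b y,
      forall x y, b (x * y) = b x * b y,
      forall a x, b (a *: x) = barA a *: b x
    & forall w, b (TW w) * TW w^-1%g = 1 /\ TW w^-1%g * b (TW w) = 1].

Definition barH : hecke -> hecke := xget (fun=> 0) is_barH.

End Hecke.

Section Compositions.
Variables r d : nat.

(* Lambda; the bound d on the entries is implied by their sum.                *)
Definition Lam : Type :=
  {l : {ffun 'I_r.+2 -> 'I_d.+1} | (\sum_i (l i : nat) == d)%N}.
HB.instance Definition _ := Finite.on Lam.

Implicit Types (l m : Lam) (w g : weyl d).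

Definition lam l (k : nat) : nat := val l (inord k).

Definition lamsum l (k : nat) : nat := (\sum_(0 <= j < k.+1) lam l j)%N.

(* W_lambda: as the generators are involutions, words are enough.             *)
Definition Wpar l : set (weyl d) :=
  [set w | exists2 s : seq 'I_d.+1, w = wprod s &
     forall i, i \in s -> forall k, (k <= r)%N -> i != lamsum l k :> nat].

Definition Dleft l : set (weyl d) :=
  [set g | forall w, Wpar l w -> ell (w * g)%g = (ell w + ell g)%N].

Definition Ddouble l m : set (weyl d) :=
  [set g | Dleft l g /\ Dleft m g^-1%g].

Definition dcoset l g m : set (weyl d) :=
  [set w | exists u v, [/\ Wpar l u, Wpar m v & w = (u * g * v)%g]].

(* R^lambda_k for 0 <= k <= r + 1.                                            *)
Definition Rblock0 l (k : nat) : set int :=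
  if k == 0%N then [set x | - (lam l 0)%:Z <= x <= (lam l 0)%:Z]
  else if (k <= r)%N then
    [set x | (lamsum l k.-1)%:Z + 1 <= x <= (lamsum l k)%:Z]
  else [set x | d%:Z + 1 - (lam l r.+1)%:Z <= x <= d%:Z + 1 + (lam l r.+1)%:Z].

(* i = i0 + q n with -r <= i0 <= r + 1; then R_i = R_{i0} + q D, where R_{i0} *)
(* is the opposite of R_{-i0} if i0 < 0.                                      *)
Definition Rblock l (i : int) : set int :=
  let q := ((i + r%:Z) %/ perN r)%Z in
  let i0 := i - q * perN r in
  [set x | let y := x - q * perD d in
           if 0 <= i0 then Rblock0 l `|i0|%N y else Rblock0 l `|i0|%N (- y)].

Definition zmx : Type := int -> int -> nat.
HB.instance Definition _ := Choice.on zmx.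

Definition kappa l g m : zmx :=
  fun i j => #|` fset_set (Rblock l i `&` (g @` Rblock m j))|%fset.

End Compositions.

Section Matrices.
Variables r d : nat.
Implicit Types (a b : zmx) (i j x y : int).

(* Sums of families of natural numbers with finite support.                   *)
Definition nsum (I : choiceType) (X : set I) (F : I -> nat) : nat :=
  \big[addn/0%N]_(i \in X) F i.

(* The finiteness condition is needed because [nsum] is 0 on families with    *)
(* infinite support.                                                          *)
Definition Xi : set zmx :=
  [set a | [/\ forall i j, a (- i) (- j) = a i j,
               forall i j, a (i + perN r) (j + perN r) = a i j,
               odd (a 0 0) && odd (a r.+1 r.+1),
               finite_set [set p : int * int |
                             1 <= p.1 <= perN r /\ a p.1 p.2 != 0%N]
             & nsum [set p : int * int | 1 <= p.1 <= perN r]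
                    (fun p => a p.1 p.2) = d.*2.+2]].

(* For odd k, (k - 1) / 2 is k./2.                                            *)
Definition rowc a : {ffun 'I_r.+2 -> nat} :=
  [ffun k : 'I_r.+2 =>
     if k == 0%N :> nat then
       ((a 0 0)./2 + nsum [set j : int | (1 <= j)%R] (a 0))%N
     else if k == r.+1 :> nat then
       ((a r.+1 r.+1)./2 + nsum [set j : int | (j <= r%:Z)%R] (a r.+1))%N
     else nsum setT (a k)].

Definition colc a : {ffun 'I_r.+2 -> nat} := rowc (fun i j => a j i).

Definition Xi_ij : set zmx :=
  [set a | Xi a /\ rowc a ord0 = 0%N /\ colc a ord0 = 0%N].

Definition sigma a i j : nat :=
  nsum [set p : int * int | p.1 <= i /\ j <= p.2] (fun p => a p.1 p.2).

Definition le_alg a b : Prop :=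
  [/\ rowc a = rowc b, colc a = colc b
    & forall i j, i < j -> (sigma a i j <= sigma b i j)%N].

Definition lt_alg a b : Prop := le_alg a b /\ a <> b.

(* The sum of the a_{xy} over x <= i, y > j and over x >= i, y < j.           *)
Definition hook a i j : nat :=
  (nsum [set p : int * int | (p.1 <= i)%R /\ (j < p.2)%R] (fun p => a p.1 p.2)
   + nsum [set p : int * int | (i <= p.1)%R /\ (p.2 < j)%R]
          (fun p => a p.1 p.2))%N.

(* The two sums are equal by the symmetry of a, so the halves are exact.      *)
Definition lc0 a : nat := (hook a 0 0)./2.
Definition lcd a : nat := (hook a r.+1 r.+1)./2.

Definition Iplus : set (int * int) :=
  [set p | [\/ p.1 = 0 /\ 0 <= p.2, 1 <= p.1 <= r%:Z
             | p.1 = r.+1 /\ p.2 <= r.+1%:Z]].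

(* a''; the division is exact as a_{00} and a_{r+1,r+1} are odd, and it may   *)
(* give -1.                                                                   *)
Definition adbl a i j : int :=
  if (i == j) && ((i == 0) || (i == r.+1)) then (((a i j)%:Z - 3) %/ 2)%Z
  else a i j.

(* Twice \hat\ell_a, i.e. the exponent of q^(1/2).                            *)
Definition la2 a : int :=
  \sum_(p \in Iplus) adbl a p.1 p.2 * (hook a p.1 p.2)%:Z.

(* The exponent of the prefactor of [A].                                      *)
Definition stdexp a : expA :=
  (la2 a, (lc0 a)%:Z - (lcd a)%:Z, (lc0 a)%:Z + (lcd a)%:Z).

End Matrices.

Section SchurModule.
Variables r d : nat.
Local Notation H := (hecke d).
Local Notation Lam := (Lam r d).
Implicit Types (l m : Lam) (P Q : pred Lam).

Definition xpar l : H := TX (Wpar l).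

(* The direct sum of the x_lambda H over the lambda in P, with its right      *)
(* H-module structure.                                                        *)
Section Module.
Variable P : pred Lam.

Definition msum_pred : {pred {ffun Lam -> H}} := fun u =>
  `[< forall l, if P l then exists h, u l = xpar l * h else u l = 0 >].

Lemma msum_submod : submod_closed msum_pred.
Proof.
split=> [|a u v /asboolP Mu /asboolP Mv]; apply/asboolP => l.
  by rewrite ffunE; case: ifP => // _; exists 0; rewrite mulr0.
rewrite !ffunE; move: (Mu l) (Mv l); case: ifP => [_ [h ->] [k ->]|_ -> ->].
  exists (a *: h + k); rewrite mulrDr.
  by rewrite (hecke_scalerAr a (xpar l) h).
by rewrite scaler0 addr0.
Qed.

HB.instance Definition _ := GRing.isSubmodClosed.Build ringA _ msum_pred
  msum_submod.

Definition msum : Type := {u : {ffun Lam -> H} | u \in msum_pred}.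
HB.instance Definition _ := SubChoice.on msum.
HB.instance Definition _ := [SubChoice_isSubLmodule of msum by <:].

Lemma mact_subproof (u : msum) (h : H) :
  [ffun l => val u l * h] \in msum_pred.
Proof.
have /asboolP Mu := valP u; apply/asboolP => l; rewrite ffunE.
move: (Mu l); case: ifP => [_ [k ->]|_ ->]; last by rewrite mul0r.
by exists (k * h); rewrite mulrA.
Qed.

Definition mact (u : msum) (h : H) : msum :=
  exist (fun v => v \in msum_pred) _ (mact_subproof u h).

(* End_H of this right H-module.                                              *)
Definition is_endo (f : msum -> msum) : Prop :=
  (forall u v, f (u + v) = f u + f v) /\
  (forall u h, f (mact u h) = mact (f u) h).

Definition schur_pred : {pred msum -> msum} := fun f => `[< is_endo f >].

Lemma msum_eq (u v : msum) : (forall l, val u l = val v l) -> u = v.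
Proof. by move=> uv; apply: val_inj; apply/ffunP. Qed.

Lemma msumZDE a (u v : msum) l : val (a *: u + v) l = a *: val u l + val v l.
Proof. by rewrite linearP !ffunE. Qed.

Lemma mactE (u : msum) h l : val (mact u h) l = val u l * h.
Proof. by rewrite ffunE. Qed.

Lemma mactZD a u v h : mact (a *: u + v) h = a *: mact u h + mact v h.
Proof.
apply: msum_eq => l; apply: etrans (mactE _ _ _) _.
apply: etrans (congr1 ( *%R^~ h) (msumZDE a u v l)) _.
apply: etrans (mulrDl _ _ _) _; apply/esym; apply: etrans (msumZDE _ _ _ _) _.
apply: etrans (congr2 (fun x y => a *: x + y) (mactE u h l) (mactE v h l)) _.
exact: (congr1 ( +%R^~ _) (hecke_scalerAl _ _ _)).
Qed.

Lemma mact0 h : mact 0 h = 0.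
Proof.
apply: msum_eq => l; rewrite mactE.
by rewrite !raddf0 ffunE mul0r.
Qed.

Lemma schur_submod : submod_closed schur_pred.
Proof.
split=> [|a f g /asboolP[fD fM] /asboolP[gD gM]]; apply/asboolP; split.
- by move=> u v; rewrite addr0.
- by move=> u h; rewrite mact0.
- by move=> u v; rewrite !fctE fD gD scalerDr addrACA.
- by move=> u h; rewrite !fctE fM gM mactZD.
Qed.

HB.instance Definition _ := GRing.isSubmodClosed.Build ringA _ schur_pred
  schur_submod.

Definition schur : Type := {f : msum -> msum | f \in schur_pred}.
HB.instance Definition _ := SubChoice.on schur.
HB.instance Definition _ := [SubChoice_isSubLmodule of schur by <:].

End Module.

(* Restriction if Q <= P, extension by zero if P <= Q.                        *)
Lemma mres_subproof P Q (u : msum P) :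
  [ffun l => if Q l then val u l else 0] \in msum_pred Q.
Proof.
have /asboolP Mu := valP u; apply/asboolP => l; rewrite ffunE.
move: (Mu l); case: (P l) => uE; case: (Q l) => //.
by exists 0; rewrite uE mulr0.
Qed.

Definition mres P Q (u : msum P) : msum Q :=
  exist (fun v => v \in msum_pred Q) _ (mres_subproof Q u).

End SchurModule.

Section SchurAlgebra.
Variables r d : nat.
Local Notation H := (hecke d).
Local Notation Lam := (Lam r d).
Implicit Types (l m nu : Lam) (a : zmx).

Definition lam_full : pred Lam := fun=> true.
Definition lam_ij : pred Lam := fun l => lam l 0 == 0%N.

(* As a module; its multiplication is the composition.                        *)
Definition schurc : Type := schur lam_full.
HB.instance Definition _ := GRing.Lmodule.on schurc.

Definition single nu (h : H) : {ffun Lam -> H} :=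
  [ffun l => if l == nu then h else 0].

Lemma xgen_subproof nu : single nu (xpar nu) \in msum_pred lam_full.
Proof.
apply/asboolP => l /=; rewrite ffunE; case: eqP => [->|_].
  by exists 1; rewrite mulr1.
by exists 0; rewrite mulr0.
Qed.

(* x_nu as an element of the direct sum.                                      *)
Definition xgen nu : msum lam_full :=
  exist (fun v => v \in msum_pred lam_full) _ (xgen_subproof nu).

(* S^ij, embedded by extending endomorphisms by zero.                         *)
Definition schur_ij : set schurc :=
  [set F | exists f : schur lam_ij,
     forall u, val F u = mres lam_full (val f (mres lam_ij u))].

Definition is_eA a (f : schurc) : Prop :=
  exists l g m, [/\ Ddouble l m g, a = kappa l g m
    & forall nu, val (val f (xgen nu)) =
                 if nu == m then single l (TX (dcoset l g m)) else 0].

Definition eA a : schurc := xget 0 (is_eA a).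

Definition std a : schurc := mono (stdexp r a) *: eA a.

(* f' is the bar conjugate of f; note that barH x_nu belongs to x_nu H.       *)
Definition is_barS (f f' : schurc) : Prop :=
  forall nu, exists u : msum lam_full,
    val u = single nu (barH (xpar nu)) /\
    val (val f' (xgen nu)) = [ffun l => barH (val (val f u) l)].

Definition barS (f : schurc) : schurc := xget 0 (is_barS f).

End SchurAlgebra.

(* The ring Z[v^(1/2), v^(-1/2)]; [mono k] is v^(k/2).                        *)
Definition ringB : comNzRingType := gring int.
Definition barB : {rmorphism ringB -> ringB} := gmap (-%R : int -> int).

Section Specialization.
Variables (r d : nat) (L : weyl d -> nat).

Definition weight_function : Prop :=
  forall w w', ell (w * w')%g = (ell w + ell w')%N ->
               L (w * w')%g = (L w + L w')%N.

Local Notation L0 := (L (sgen ord0)).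
Local Notation L1 := (L (sgen (inord 1))).
Local Notation Ld := (L (sgen ord_max)).

Definition specexp (k : expA) : int :=
  - L1%:Z * k.1.1 + (- L0%:Z + Ld%:Z) * k.1.2 + (- L0%:Z - Ld%:Z) * k.2.

Lemma specexp_is_zmod : zmod_morphism specexp.
Proof. by case=> [[a b] c] [[a' b'] c']; rewrite /specexp /=; ring. Qed.

HB.instance Definition _ := GRing.isZmodMorphism.Build expA int specexp
  specexp_is_zmod.

Definition specL : {rmorphism ringA -> ringB} := gmap specexp.

Definition schurL : Type := bchange specL (schurc r d).
HB.instance Definition _ := GRing.Lmodule.on schurL.

Definition stdL (a : zmx) : schurL := tens specL 1 (std r d a).

Definition schurL_ij : set schurL :=
  spanned [set x | exists2 f, schur_ij f & x = tens specL 1 f].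

Definition is_barL (b : schurL -> schurL) : Prop :=
  (forall x y, b (x + y) = b x + b y) /\
  (forall c f, b (tens specL c f) = tens specL (barB c) (barS f)).

Definition barL : schurL -> schurL := xget (fun=> 0) is_barL.

Definition cL : nat := gcdn `|L0%:Z - Ld%:Z|%N (gcdn (L0 + Ld) L1).

(* v^(-c) Z[v^(-c)]                                                           *)
Definition vneg : set ringB :=
  [set x | exists p : {poly int},
     let y : ringB := mono (- (cL.*2)%:Z) in x = y * (map_poly intr p).[y]].

(* x is in [A] + sum_(B in X, B < A) v^(-c) Z[v^(-c)] [B]                     *)
Definition unitri (X : set zmx) (a : zmx) (x : schurL) : Prop :=
  exists (s : seq zmx) (p : zmx -> ringB),
    (forall b, b \in s -> [/\ X b, lt_alg r b a & vneg (p b)]) /\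
    x = stdL a + \sum_(b <- s) p b *: stdL b.

End Specialization.

(* The family (b_i), i in I, is a basis of the submodule M.                   *)
Definition is_basis (R : nzRingType) (V : lmodType R) (J : choiceType)
    (I : set J) (b : J -> V) (M : set V) : Prop :=
  [/\ forall i, I i -> M (b i),
      forall x, M x -> exists (s : seq J) (c : J -> R),
        (forall i, i \in s -> I i) /\ x = \sum_(i <- s) c i *: b i
    & forall (s : seq J) (c : J -> R), uniq s -> (forall i, i \in s -> I i) ->
        \sum_(i <- s) c i *: b i = 0 -> forall i, i \in s -> c i = 0].

Definition canonical_basis (r d : nat) (L : weyl d -> nat) (X : set zmx)
    (M : set (schurL r L)) (C : zmx -> schurL r L) : Prop :=
  [/\ is_basis X C M,
      forall a, X a -> barL (C a) = C a
    & forall a, X a -> unitri X a (C a)].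

(* Main.v *)
Require Import Defs.
From mathcomp Require Import all_boot all_order all_algebra.
From mathcomp Require Import finmap.
From mathcomp Require Import boolp classical_sets cardinality fsbigop.
From mathcomp Require Import monalg zify.

(** The part of the canonical basis of S^(c,L) that lies in S^(ij,L) is the part
    indexed by Xi^ij, so the required basis is the restriction of the given
    one to Xi^ij.

    Let e be the idempotent of S^c that projects the direct sum of the modules
    x_lambda H onto the summands with lambda_0 = 0. Then S^ij = e S^c e, and
    the corner map f |-> e f e is an idempotent linear map with image S^ij
    ([schur_ij_corner]). The element e_A with A = kappa(lambda, g, mu) only
    maps the summand of mu to the summand of lambda, so e e_A e is e_A if
    lambda_0 = mu_0 = 0 and is 0 otherwise ([corner_elementary]). Since
    row_c(A)_0 = 0 exactly when lambda_0 = 0, and col_c(A)_0 = 0 exactly when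
    mu_0 = 0 ([Xi_ij_kappa]), the corner map fixes [A] if A belongs to Xi^ij
    and kills it if not ([corner_std]). It induces a linear map on the base
    change S^(c,L) ([bchange_corner]).

    The order <=_alg compares only matrices with equal row_c and col_c, so B
    belongs to Xi^ij if and only if A does whenever B <_alg A
    ([lt_alg_Xi_ij]). By unitriangularity, the elements {A} with A in Xi^ij lie
    in S^(ij,L) and are unitriangular over Xi^ij, while the corner map kills
    the other {A}. Applying the corner map to the expansion of an element of
    S^(ij,L) in the basis {A} then leaves only terms with A in Xi^ij; and an
    {A} in S^(ij,L) with A not in Xi^ij would be fixed and killed, contrary to
    linear independence. *)

Set Implicit Arguments.
Unset Strict Implicit.
Unset Printing Implicit Defensive.

Import Order.TTheory GRing.Theory Num.Theory.
Local Open Scope classical_set_scope.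
Local Open Scope ring_scope.

(** * Linear maps out of a base change *)

Lemma spanned_gen (R : pzRingType) (V : lmodType R) (S : set V) x :
  S x -> spanned S x.
Proof.
move=> Sx; rewrite -[x]addr0 -[x]scale1r.
by constructor; last by constructor.
Qed.

Section BaseChangeMap.
Variables (A B : comNzRingType) (phi : {rmorphism A -> B}) (M : lmodType A).

Lemma tensD m m' :
  tens phi 1 (m + m') = tens phi 1 m + tens phi 1 m' :> bchange phi M.
Proof.
rewrite /tens -(raddfD (piq (tens_rel phi (M := M)))); apply/piqP.
rewrite !scale1r opprD addrA; apply: spanned_gen.
by left; exists m, m'.
Qed.

Lemma tensZ a m : tens phi 1 (a *: m) = phi a *: tens phi 1 m :> bchange phi M.
Proof.
rewrite /tens -piq_scalable; apply/piqP.
rewrite !scale1r; apply: spanned_gen.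
by right; exists a, m.
Qed.

Variables (V : lmodType B) (psi : M -> V).
Hypothesis psiD : forall m m', psi (m + m') = psi m + psi m'.
Hypothesis psiZ : forall a m, psi (a *: m) = phi a *: psi m.

(** The linear extension of psi to the free B-module on M. *)
Definition free_map (x : {malg B[M]}) : V := \sum_(k <- msupp x) x@_k *: psi k.

Lemma free_mapEw x (D : {fset M}) : (msupp x `<=` D)%fset ->
  free_map x = \sum_(k <- D) x@_k *: psi k.
Proof.
move=> sD; rewrite /free_map (big_fset_incl _ sD) //= => k _ /mcoeff_outdom ->.
by rewrite scale0r.
Qed.

Lemma free_mapD x y : free_map (x + y) = free_map x + free_map y.
Proof.
pose D := (msupp x `|` msupp y)%fset.
rewrite (@free_mapEw x D) ?fsubsetUl // (@free_mapEw y D) ?fsubsetUr //.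
rewrite (@free_mapEw (x + y) D); last exact: msuppD_le.
rewrite -big_split /=; apply: eq_bigr => k _.
by rewrite mcoeffD scalerDl.
Qed.

Lemma free_mapZ b x : free_map (b *: x) = b *: free_map x.
Proof.
rewrite (@free_mapEw (b *: x) (msupp x)); last exact: msuppZ_le.
rewrite scaler_sumr; apply: eq_bigr => k _.
by rewrite mcoeffZ scalerA.
Qed.

Lemma free_mapU k : free_map << k >> = psi k.
Proof.
rewrite (@free_mapEw _ [fset k]%fset) ?big_seq_fset1 ?mcoeffUU ?scale1r //.
exact: msuppU_le.
Qed.

(** As psi is semilinear, its extension vanishes on the bilinearity relations,
    hence factors through the base change. *)
Lemma free_map_rel x : spanned (tens_rel phi (M := M)) x -> free_map x = 0.
Proof.
have N y : free_map (- y) = - free_map y.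
  by rewrite -[X in free_map X]scaleN1r free_mapZ scaleN1r.
elim=> [|b y z Sy _ IH]; first by rewrite /free_map msupp0 big_nil.
rewrite free_mapD free_mapZ IH addr0.
case: Sy => [[m [m' ->]]|[a [m ->]]].
  rewrite !free_mapD !N !free_mapU psiD.
  by rewrite [X in b *: X]addrAC addrK subrr scaler0.
by rewrite free_mapD N free_mapZ !free_mapU psiZ subrr scaler0.
Qed.

(** The universal property of the base change, without the uniqueness. *)
Lemma bchange_map : exists F : bchange phi M -> V,
  [/\ forall x y, F (x + y) = F x + F y, forall b x, F (b *: x) = b *: F x
    & forall m, F (tens phi 1 m) = psi m].
Proof.
pose F (x : bchange phi M) := free_map (repr x).
have FE x : F (piq _ x) = free_map x.
  have /piqP/free_map_rel := piqK (piq (tens_rel phi (M := M)) x).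
  rewrite free_mapD -scaleN1r free_mapZ scaleN1r => /eqP.
  by rewrite subr_eq0 => /eqP.
exists F; split.
- by elim/piq_ind=> x; elim/piq_ind=> y;
    rewrite -(raddfD (piq (tens_rel phi (M := M)))) !FE free_mapD.
- by move=> b; elim/piq_ind=> x; rewrite -piq_scalable !FE free_mapZ.
- by move=> m; rewrite /tens FE free_mapZ free_mapU scale1r.
Qed.

End BaseChangeMap.

(** * The corner map on the Schur algebra *)

Section Corner.
Variables r d : nat.
Local Notation full := (@lam_full r d).
Local Notation ij := (@lam_ij r d).

Lemma mresE (P Q : pred (Lam r d)) (u : msum P) l :
  val (mres Q u) l = if Q l then val u l else 0.
Proof. by rewrite ffunE. Qed.

Lemma mresZD (P Q : pred (Lam r d)) a (u v : msum P) :
  mres Q (a *: u + v) = a *: mres Q u + mres Q v.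
Proof.
apply: msum_eq => l; rewrite mresE !msumZDE !mresE.
by case: ifP => // _; rewrite scaler0 addr0.
Qed.

Lemma mresD (P Q : pred (Lam r d)) (u v : msum P) :
  mres Q (u + v) = mres Q u + mres Q v.
Proof. by have := mresZD Q 1 u v; rewrite !scale1r. Qed.

Lemma mres_mact (P Q : pred (Lam r d)) (u : msum P) h :
  mres Q (mact u h) = mact (mres Q u) h.
Proof.
apply: msum_eq => l; apply: etrans (mresE _ _ _) _.
apply: etrans _ (esym (mactE _ _ _)); rewrite mresE.
by case: ifP => _; [apply: mactE|rewrite mul0r].
Qed.

(** The idempotent e: the projection of the direct sum of all x_lambda H onto
    the summands with lambda_0 = 0. *)
Definition cut (u : msum full) : msum full := mres full (mres ij u).

Lemma cutE u l : val (cut u) l = if ij l then val u l else 0.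
Proof. by rewrite !mresE. Qed.

Lemma cutK u : mres ij (cut u) = mres ij u.
Proof. by apply: msum_eq => l; rewrite !mresE /=; case: (lam_ij l). Qed.

Lemma schur_endo (P : pred (Lam r d)) (f : schur P) : is_endo (val f).
Proof. exact/asboolP/(valP f). Qed.

Lemma corner_subproof (f : schurc r d) :
  (fun u => cut (val f (cut u))) \in @schur_pred r d full.
Proof.
have [fD fM] := schur_endo f; apply/asboolP; split=> [u v|u h].
  by rewrite /cut !mresD fD !mresD.
by rewrite /cut !mres_mact fM !mres_mact.
Qed.

(** The corner map f |-> e f e, as an endomorphism of S^c. *)
Definition corner (f : schurc r d) : schurc r d :=
  exist (fun g => g \in @schur_pred r d full) _ (corner_subproof f).

Lemma cornerE f u : val (corner f) u = cut (val f (cut u)).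
Proof. by []. Qed.

Lemma schurZDE a (f g : schurc r d) u :
  val (a *: f + g) u = a *: val f u + val g u.
Proof. by rewrite linearP. Qed.

Lemma cornerZD a f g : corner (a *: f + g) = a *: corner f + corner g.
Proof.
apply: val_inj; apply: funext => u.
apply: etrans (cornerE _ _) _; rewrite schurZDE /cut !mresZD.
exact/esym/schurZDE.
Qed.

Lemma corner0 : corner 0 = 0.
Proof. by have := cornerZD (-1) 0 0; rewrite scaler0 addr0 scaleN1r addNr. Qed.

Lemma cornerD f g : corner (f + g) = corner f + corner g.
Proof. by have := cornerZD 1 f g; rewrite !scale1r. Qed.

Lemma cornerZ a f : corner (a *: f) = a *: corner f.
Proof. by have := cornerZD a f 0; rewrite corner0 !addr0. Qed.

Lemma schur_ij_corner (f : schurc r d) : schur_ij f <-> corner f = f.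
Proof.
split=> [[g fg]|cf].
  apply: val_inj; apply: funext => u; rewrite cornerE.
  rewrite !fg cutK; apply: msum_eq => l; rewrite cutE !mresE /=.
  case: ifP => // nl; have /asboolP/(_ l) := valP (val g (mres ij u)).
  by rewrite nl => ->.
have [fD fM] := schur_endo f.
have gP : (fun u => mres ij (val f (mres full u))) \in @schur_pred r d ij.
  apply/asboolP; split=> [u v|u h]; first by rewrite !mresD fD mresD.
  by rewrite !mres_mact fM mres_mact.
by exists (exist (fun g => g \in @schur_pred r d ij) _ gP) => u; rewrite -{1}cf.
Qed.

(** Every element of the direct sum is a combination of the generators
    x_nu; the coefficients need not be unique. *)
Lemma msum_coords (u : msum full) :
  exists h : Lam r d -> hecke d, forall l, val u l = xpar l * h l.
Proof.
have /asboolP Mu := valP u.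
have /choice[h uE] : forall l, exists h, val u l = xpar l * h by exact: Mu.
by exists h.
Qed.

Lemma xgen_mactE (nu l : Lam r d) (h : hecke d) :
  val (mact (xgen nu) h) l = if l == nu then xpar nu * h else 0.
Proof.
apply: etrans (mactE _ _ _) _; rewrite ffunE.
by case: eqP => // _; rewrite mul0r.
Qed.

Lemma msum_xgen (u : msum full) (h : Lam r d -> hecke d) :
  (forall l, val u l = xpar l * h l) -> u = \sum_nu mact (xgen nu) (h nu).
Proof.
move=> uE; apply: msum_eq => l.
rewrite (big_morph (fun v : msum full => val v l) (id1 := 0) (op1 := +%R)).
- rewrite (bigD1 l) //= big1 ?addr0 => [|nu nl].
    by have := xgen_mactE l l (h l); rewrite eqxx uE => ->.
  by have := xgen_mactE nu l (h nu); rewrite eq_sym (negbTE nl).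
- by move=> v w; have := msumZDE 1 v w l; rewrite !scale1r.
- by rewrite raddf0 ffunE.
Qed.

(** An endomorphism that maps x_m to an element of the summand l, and the other
    generators to 0, is determined by the coefficient at x_m. *)
Lemma elementary_endo (f : schurc r d) (l m : Lam r d) t :
    (forall nu, val (val f (xgen nu)) = if nu == m then single l t else 0) ->
  forall (u : msum full) h, (forall nu, val u nu = xpar nu * h nu) ->
  val (val f u) = single l (t * h m).
Proof.
move=> fE u h /msum_xgen ->; have [fD fM] := schur_endo f.
have f0 : val f 0 = 0.
  by apply: (addrI (val f 0)); rewrite -fD !addr0.
rewrite (big_morph (val f) fD f0) (bigD1 m) //= big1 ?addr0 => [|nu nm].
  apply/ffunP => k; rewrite fM; apply: etrans (mactE _ _ _) _.
  by rewrite fE eqxx !ffunE; case: eqP => // _; rewrite mul0r.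
rewrite fM; apply: msum_eq => k; apply: etrans (mactE _ _ _) _.
by rewrite fE (negbTE nm) raddf0 !ffunE mul0r.
Qed.

Lemma corner_elementary (f : schurc r d) (l m : Lam r d) t :
    (forall nu, val (val f (xgen nu)) = if nu == m then single l t else 0) ->
  corner f = if ij l && ij m then f else 0.
Proof.
move=> fE; apply: val_inj; apply: funext => u; rewrite cornerE.
have [h uE] := msum_coords u.
pose h' nu := if ij nu then h nu else 0.
have cE nu : val (cut u) nu = xpar nu * h' nu.
  by rewrite cutE /h' uE; case: (ij nu); rewrite ?mulr0.
have fu := elementary_endo fE uE; have fcu := elementary_endo fE cE.
apply: msum_eq => k; rewrite cutE fcu ffunE.
have [/andP[il im]|ilm] := boolP (ij l && ij m).
  by rewrite fu ffunE /h' im; case: eqP => [->|]; rewrite ?il ?if_same.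
transitivity (0 : hecke d); last by rewrite !raddf0 ffunE.
case: ifP => // ik; case: eqP => // kl; move: ilm; rewrite -kl ik /h' /=.
by move/negbTE => ->; rewrite mulr0.
Qed.

End Corner.

(** * Sums and cardinals *)

Lemma nsum_eq0 (I : choiceType) (X : set I) (F : I -> nat) :
  (forall i, X i -> F i = 0%N) -> nsum X F = 0%N.
Proof. exact: fsbig1. Qed.

(** Finite support is needed, since [nsum] is 0 otherwise. *)
Lemma nsum_gt0 (I : choiceType) (X : set I) (F : I -> nat) i :
  finite_set [set j | F j != 0%N] -> X i -> F i != 0%N -> nsum X F != 0%N.
Proof.
move=> finF Xi Fi; rewrite /nsum fsbig_supp fsbig_finite; last first.
  by apply: sub_finite_set finF => j [_ /eqP].
rewrite (big_fsetD1 i) /=; first by rewrite addn_eq0 (negbTE Fi).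
rewrite in_fset_set; first by rewrite inE; split=> //; apply/eqP.
by apply: sub_finite_set finF => j [_ /eqP].
Qed.

Lemma finite_int_itv (a b : int) : finite_set [set x : int | a <= x <= b].
Proof.
apply: (@sub_finite_set _ _ ((fun n : nat => a + n%:Z) @` `I_(`|b - a|.+1))).
  by move=> x /= ?; exists `|x - a|%N; lia.
exact/finite_image/finite_II.
Qed.

Lemma card_set_gt0 (X : set int) x : finite_set X -> X x ->
  #|` fset_set X| != 0%N.
Proof.
move=> fX Xx; rewrite cardfs_eq0; apply/eqP => /(congr1 (fun s => x \in s)).
by rewrite in_fset_set // in_fset0 mem_set.
Qed.

Lemma card_set_gt1 (X : set int) x y : finite_set X -> X x -> X y -> x != y ->
  (1 < #|` fset_set X|)%N.
Proof.
move=> fX Xx Xy xy; apply: (@leq_trans #|` [fset x; y]%fset|).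
  by rewrite cardfs2 xy.
apply/fsubset_leq_card/fsubsetP => z; rewrite !inE in_fset_set // => /orP.
by case=> /eqP ->; rewrite inE.
Qed.

Lemma card_set_le1 (X : set int) x : X `<=` [set x] ->
  (#|` fset_set X| <= 1)%N.
Proof.
move=> Xx; have fX : finite_set X by apply: sub_finite_set Xx (finite_set1 x).
rewrite -(cardfs1 x); apply/fsubset_leq_card/fsubsetP => z.
by rewrite in_fset_set // !inE => /Xx ->.
Qed.

(** * The blocks R_i and the entries of row 0 and column 0 *)

Section Blocks.
Variables r d : nat.
Implicit Types (l m : Lam r d) (g : weyl d) (a : zmx).

Lemma lamsumS l k : lamsum l k.+1 = (lamsum l k + lam l k.+1)%N.
Proof. by rewrite /lamsum big_nat_recr. Qed.

Lemma lamsum0 l : lamsum l 0 = lam l 0.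
Proof. by rewrite /lamsum big_nat1. Qed.

Lemma lamsum_total l : lamsum l r.+1 = d.
Proof.
rewrite -[RHS](eqP (valP l)) /lamsum big_mkord; apply: eq_bigr => i _.
by rewrite /lam inord_val.
Qed.

Lemma lamsum_le l : (lamsum l r + lam l r.+1)%N = d.
Proof. by rewrite -lamsumS lamsum_total. Qed.

Lemma leq_lamsum l i j : (i <= j)%N -> (lamsum l i <= lamsum l j)%N.
Proof.
move=> /subnK <-; elim: (j - i)%N => // k IH.
by rewrite addSn lamsumS (leq_trans IH) ?leq_addr.
Qed.

(** The definition of R_i, with the representatives of i modulo n in [-r, r + 1]
    split by sign. *)
Lemma RblockE l (k : nat) (q y : int) : (k <= r.+1)%N ->
  Rblock l (k%:Z + q * perN r) y <-> Rblock0 l k (y - q * perD d).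
Proof.
move=> kr; rewrite /Rblock /=.
have -> : ((k%:Z + q * perN r + r%:Z) %/ perN r)%Z = q.
  rewrite addrAC addrC divzMDl ?divz_small ?addr0 //; rewrite /perN; lia.
by rewrite addrK /=.
Qed.

Lemma RblockNE l (k : nat) (q y : int) : (0 < k <= r)%N ->
  Rblock l (- k%:Z + q * perN r) y <-> Rblock0 l k (q * perD d - y).
Proof.
move=> kr; rewrite /Rblock /=.
have -> : ((- k%:Z + q * perN r + r%:Z) %/ perN r)%Z = q.
  rewrite addrAC addrC divzMDl ?divz_small ?addr0 //; rewrite /perN; lia.
rewrite addrK ifF ?absz_nat ?abszN ?opprB //; lia.
Qed.

Lemma Rblock_0 l y : Rblock l 0 y <-> - (lam l 0)%:Z <= y <= (lam l 0)%:Z.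
Proof. by have := @RblockE l 0 0 y isT; rewrite !mul0r addr0 subr0. Qed.

(** Euclidean division with remainders in [-a, b]. *)
Lemma int_quo_rem (i : int) (a b N : nat) : N = (a + b).+1 ->
  exists (q x : int), i = x + q * N%:Z /\ (- a%:Z <= x <= b%:Z).
Proof.
move=> NE; exists ((i + a%:Z) %/ N)%Z, (i - ((i + a%:Z) %/ N)%Z * N%:Z).
split; first by rewrite subrK.
have := divz_eq (i + a%:Z) N%:Z.
have := @modz_ge0 (i + a%:Z) N%:Z; have := @ltz_pmod (i + a%:Z) N%:Z.
set q := (_ %/ _)%Z; set t := (_ %% _)%Z; set qN := q * _.
lia.
Qed.

Lemma Rblock0_cover l (x : nat) : (x <= d.+1)%N ->
  exists2 k : nat, (k <= r.+1)%N & Rblock0 l k x.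
Proof.
move=> xd; have [xl|xl] := leqP x (lam l 0).
  by exists 0%N => //; rewrite /Rblock0 /=; lia.
have [xr|xr] := leqP x (lamsum l r); last first.
  exists r.+1; rewrite // /Rblock0 /= ltnn /=.
  by have := lamsum_le l; lia.
have ex : exists k, (x <= lamsum l k)%N by exists r.
case: (ex_minnP ex) => k xk kmin.
have k0 : k != 0%N by apply/eqP => k0; move: xk; rewrite k0 lamsum0; lia.
have kr : (k <= r)%N by apply: kmin.
exists k; first exact: leqW.
rewrite /Rblock0 (negbTE k0) kr /=; have := kmin k.-1.
by case: (leqP x (lamsum l k.-1)) => //; lia.
Qed.

(** The blocks R_j cover the integers. *)
Lemma Rblock_cover l (y : int) : exists j, Rblock l j y.
Proof.
have [q [x [yE xb]]] := @int_quo_rem y d d.+1 d.*2.+2 ltac:(lia).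
have [k kr Rk] := @Rblock0_cover l `|x|%N ltac:(lia).
have [x0|x0] := leP 0 x.
  exists (k%:Z + q * perN r); apply/RblockE => //.
  by rewrite yE addrK; move: Rk; rewrite gez0_abs.
have [k0|k0] := posnP k.
  exists (k%:Z + q * perN r); apply/RblockE => //; move: Rk.
  by rewrite yE addrK k0 /Rblock0 /=; lia.
have [kr'|kr'] := leqP k r.
  exists (- k%:Z + q * perN r); apply/RblockNE; first by rewrite k0.
  by rewrite yE /perD opprD addrCA subrr addr0 -(ltz0_abs x0).
(* -R_(r+1) is R_(r+1) - D, the block of index r + 1 - n. *)
have {kr kr' k0} kE : k = r.+1 by lia.
exists (r.+1%:Z + (q - 1) * perN r); apply/RblockE => //.
rewrite yE /perD mulrBl mul1r opprB addrACA subrr addr0.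
move: Rk; rewrite kE /Rblock0 /= ltnn /=.
by have := lamsum_le l; lia.
Qed.

Lemma Rblock_gt0 l (j : int) : 1 <= j -> ~ Rblock l j 0.
Proof.
have [q [x [-> xb]]] := @int_quo_rem j r r.+1 r.*2.+2 ltac:(lia).
have sl := lamsum_le l; have l0 := leq_lamsum l (leq0n r).
rewrite lamsum0 in l0.
move=> j1; have q0 : 0 <= q by nia.
have qD : q = 0 \/ d.*2.+2%:Z <= q * perD d by rewrite /perD; nia.
have [x0|x0] := leP 0 x.
  rewrite -(gez0_abs x0) => /RblockE; rewrite sub0r => /(_ ltac:(lia)).
  rewrite /Rblock0; case: eqP => [xE|/eqP xE].
    by case: qD => [qE|]; [rewrite qE in j1; lia|rewrite /=; lia].
  by case: ifP => xr /=; case: qD => [->|]; lia.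
rewrite -(opprK x) -(ltz0_abs x0) => /RblockNE.
rewrite subr0 => /(_ ltac:(lia)).
have xr : (`|x| <= r)%N by lia.
have := leq_lamsum l xr; rewrite /Rblock0 xr.
case: eqP => [xE|/eqP xE /=]; first by lia.
by case: qD => [qE|]; [rewrite qE in j1; lia|lia].
Qed.

Lemma weyl_0 g : g 0 = 0.
Proof.
have [_ _ /(_ 0)] := weylP g; rewrite oppr0; move: (wact g 0) => x xN.
lia.
Qed.

Lemma finite_Rblock_0 l : finite_set (Rblock l 0).
Proof.
apply: sub_finite_set (finite_int_itv (- (lam l 0)%:Z) (lam l 0)%:Z) => y.
by move/Rblock_0.
Qed.

(** Column 0 of kappa(l, g, m) is row 0 of kappa(m, g^-1, l); the block R_0 is
    finite, so both entries are true cardinals. *)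
Lemma kappa_tr l g m i : kappa l g m i 0 = kappa m (weylV g) l 0 i.
Proof.
have [bg _ _] := weylP g; have [K1 K2] := Defs.finvK bg.
have fin : finite_set (Rblock m 0 `&` (weylV g @` Rblock l i)).
  by apply: sub_finite_set (finite_Rblock_0 m) => y [].
rewrite /kappa; have -> : Rblock l i `&` (g @` Rblock m 0) =
    g @` (Rblock m 0 `&` (weylV g @` Rblock l i)).
  apply/seteqP; split=> y /=.
    by move=> [ly [x mx gx]]; exists x => //; split=> //; exists y => //;
      rewrite -gx.
  move=> [x [mx [z lz zx]] <-]; split; last by exists x.
  by rewrite -zx; move: lz; rewrite -{1}(K1 z).
rewrite fset_set_image // card_imfset //; exact: bij_inj.
Qed.

(** If l_0 > 0, then 1 belongs to R_0 and to some g R_j: either j = 0, and then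
    a_00 >= 2 because 0 is also common to R_0 and g R_0, or a_0j = a_0,-j is
    positive. If l_0 = 0, then R_0 = {0}, while g 0 = 0 belongs to no g R_j
    with j >= 1. Only row 0 of a matters, so that the statement also applies to
    transposes. *)
Lemma rowc_kappa_eq0 a l g m :
    (forall j, a 0 j = kappa l g m 0 j) -> (forall j, a 0 (- j) = a 0 j) ->
    finite_set [set j | a 0 j != 0%N] ->
  rowc r a ord0 = 0%N <-> lam l 0 = 0%N.
Proof.
move=> aE aN afin; rewrite ffunE /=; split=> [/eqP|l0].
  rewrite addn_eq0 => /andP[a00 /eqP aj]; apply/eqP/negPn/negP => l0.
  have bl y : - 1 <= y <= 1 -> Rblock l 0 y by move=> ?; apply/Rblock_0; lia.
  have fin j : finite_set (Rblock l 0 `&` (g @` Rblock m j)).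
    by apply: sub_finite_set (finite_Rblock_0 l) => y [].
  have [bg _ _] := weylP g; have [K1 K2] := Defs.finvK bg.
  have [j mj] := Rblock_cover m (weylV g 1).
  have aj0 : a 0 j != 0%N.
    rewrite aE; apply: (card_set_gt0 (x := 1)) => //; split; first exact: bl.
    by exists (weylV g 1); last exact: K1.
  have [j0|j0|j0] := ltgtP j 0.
  - have := @nsum_gt0 _ [set j : int | (1 <= j)%R] (a 0) (- j) afin.
    by rewrite aN aj => /(_ _ aj0) /eqP; apply => /=; lia.
  - have := @nsum_gt0 _ [set j : int | (1 <= j)%R] (a 0) j afin.
    by rewrite aj => /(_ _ aj0) /eqP; apply => /=; lia.
  - suff : (1 < a 0 0)%N by case: (a 0 0) a00 => [|[]].
    rewrite aE; apply: (card_set_gt1 (x := 0) (y := 1)) => //.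
      by split; [apply: bl|exists 0; [apply/Rblock_0; lia|apply: weyl_0]].
    by split; [apply: bl|exists (weylV g 1); [move: mj; rewrite j0|apply: K1]].
have bl y : Rblock l 0 y -> y = 0 by move/Rblock_0; lia.
rewrite nsum_eq0 ?addn0 => [|j /= j1]; last first.
  rewrite aE /kappa; suff -> : Rblock l 0 `&` (g @` Rblock m j) = set0.
    by rewrite fset_set0.
  apply/seteqP; split=> // y [/bl y0 [x mx gx]].
  have [bg _ _] := weylP g.
  have x0 : x = 0 by apply: (bij_inj bg); rewrite weyl_0 gx.
  by apply: (@Rblock_gt0 m j j1); rewrite -x0.
suff : (a 0 0 <= 1)%N by case: (a 0 0) => [|[]].
by rewrite aE; apply: (card_set_le1 (x := 0)) => y [/bl].
Qed.

(** By periodicity, row 0 is a translate of row n, which is one of the rows on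
    which finiteness is assumed. *)
Lemma Xi_row_finite a : Xi r d a -> finite_set [set j | a 0 j != 0%N].
Proof.
case=> _ aP _ afin _.
apply: (@sub_finite_set _ _ ((fun p : int * int => p.2 - p.1) @`
  [set p : int * int | 1 <= p.1 <= perN r /\ a p.1 p.2 != 0%N])).
  move=> j /= aj; exists (perN r, j + perN r); rewrite /= ?addrK //.
  by rewrite -[X in a X]add0r aP; split=> //; rewrite /perN; lia.
exact: finite_image.
Qed.

(** By periodicity, each entry of column 0 occurs in one of the rows 1, ..., n,
    and its index i is the difference of the coordinates there. *)
Lemma Xi_col_finite a : Xi r d a -> finite_set [set i | a i 0 != 0%N].
Proof.
case=> _ aP _ afin _.
have aPn (q : int) i j : a (i + q * perN r) (j + q * perN r) = a i j.
  have aPN (n : nat) x y : a (x + n%:Z * perN r) (y + n%:Z * perN r) = a x y.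
    elim: n x y => [|n IH] x y; first by rewrite mul0r !addr0.
    by rewrite -addn1 PoszD mulrDl mul1r !addrA aP IH.
  have [q0|q0] := leP 0 q; first by rewrite -(gez0_abs q0).
  rewrite -(aPN `|q|%N) (ltz0_abs q0) -!addrA -!mulrDl subrr mul0r !addr0 //.
apply: (@sub_finite_set _ _ ((fun p : int * int => p.1 - p.2) @`
  [set p : int * int | 1 <= p.1 <= perN r /\ a p.1 p.2 != 0%N])).
  move=> i /= ai.
  have [q [x [iE xb]]] := @int_quo_rem (i - 1) 0 r.*2.+1 r.*2.+2 ltac:(lia).
  exists (i - q * perN r, - (q * perN r)); rewrite /= ?opprK ?subrK //; split.
    by rewrite /perN; lia.
  by rewrite -(aPn q) subrK addNr.
exact: finite_image.
Qed.

(** Membership of kappa(l, g, m) in Xi^ij depends only on l and m. *)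
Lemma Xi_ij_kappa a l g m : Xi r d a -> a = kappa l g m ->
  Xi_ij r d a <-> lam l 0 = 0%N /\ lam m 0 = 0%N.
Proof.
move=> Xa aE; have [aN _ _ _ _] := Xa.
have R : rowc r a ord0 = 0%N <-> lam l 0 = 0%N.
  apply: (@rowc_kappa_eq0 _ l g m); [by rewrite aE| |exact: Xi_row_finite].
  by move=> j; rewrite -[X in a X]oppr0 aN.
have C : colc r a ord0 = 0%N <-> lam m 0 = 0%N.
  apply: (@rowc_kappa_eq0 (fun i j => a j i) m (weylV g) l) => [j|j|].
  - by rewrite aE kappa_tr.
  - by rewrite -[X in a _ X]oppr0 aN.
  - exact: Xi_col_finite.
by split=> [[_ [/R ? /C ?]]|[/R ? /C ?]].
Qed.

End Blocks.

(** * The corner map on the standard basis and after specialization *)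

Section Specialized.
Variables (r d : nat) (L : weyl d -> nat).
Local Notation tens1 := (tens (specL L) 1).

(** If no endomorphism has the defining property of e_A, then [eA] is 0 and
    there is nothing to prove. *)
Lemma corner_eA a : Xi r d a ->
  corner (eA r d a) = if `[< Xi_ij r d a >] then eA r d a else 0.
Proof.
move=> Xa; rewrite /eA; case: xgetP => [f _ [l [g [m [_ aE fE]]]]|_].
  2: by rewrite corner0 if_same.
rewrite (corner_elementary fE); congr (if _ then _ else _).
have E := Xi_ij_kappa Xa aE.
apply/idP/asboolP => [/andP[/eqP l0 /eqP m0]|/E[l0 m0]]; first exact/E.
by rewrite /lam_ij l0 m0.
Qed.

Lemma corner_std a : Xi r d a ->
  corner (std r d a) = if `[< Xi_ij r d a >] then std r d a else 0.
Proof.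
move=> Xa; rewrite /std cornerZ corner_eA //.
by case: ifP => // _; rewrite scaler0.
Qed.

Lemma bchange_corner : exists F : schurL r L -> schurL r L,
  [/\ forall x y, F (x + y) = F x + F y, forall b x, F (b *: x) = b *: F x
    & forall f : schurc r d, F (tens1 f) = tens1 (corner f)].
Proof.
apply: bchange_map => [f g|a f]; first by rewrite cornerD tensD.
by rewrite cornerZ tensZ.
Qed.

(** The order <_alg compares only matrices with the same row_c and col_c. *)
Lemma lt_alg_Xi_ij a b : Xi r d a -> Xi r d b -> lt_alg r b a ->
  Xi_ij r d b <-> Xi_ij r d a.
Proof.
by move=> Xa Xb [[ra ca _] _]; rewrite /Xi_ij /= ra ca; split=> -[_].
Qed.

Lemma schurL_ij_std a : Xi_ij r d a -> schurL_ij (stdL r L a : schurL r L).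
Proof.
move=> Xa; apply: spanned_gen.
exists (std r d a) => //; apply/schur_ij_corner.
by rewrite corner_std; [rewrite asboolT|case: Xa].
Qed.

Lemma schurL_ij_unitri a (x : schurL r L) : Xi_ij r d a ->
  unitri (Xi_ij r d) a x -> schurL_ij x.
Proof.
move=> Xa [s [p [sX ->]]]; apply: spannedD; first exact: schurL_ij_std.
elim: s sX => [|b s IH] sX; first by rewrite big_nil; constructor.
rewrite big_cons; apply: spannedD.
  by apply/spannedZ/schurL_ij_std; have [] := sX b (mem_head _ _).
by apply: IH => c cs; apply: sX; rewrite inE cs orbT.
Qed.

Lemma unitri_Xi_ij a (x : schurL r L) : Xi_ij r d a ->
  unitri (Xi r d) a x -> unitri (Xi_ij r d) a x.
Proof.
move=> Xa [s [p [sX ->]]]; exists s, p; split=> // b bs.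
have [Xb ba pb] := sX b bs; split=> //.
by apply/(lt_alg_Xi_ij _ Xb ba) => //; case: Xa.
Qed.

End Specialized.

Theorem theorem5p15 (r d : nat) (hd : (2 <= d)%N)
    (L : weyl d -> nat) (hL : weight_function L)
    (Bc : zmx -> schurL r L)
    (hBc : canonical_basis (Xi r d) setT Bc) :
  exists Bij : zmx -> schurL r L,
    [/\ is_basis (Xi_ij r d) Bij (@schurL_ij r d L),
        forall A, Xi_ij r d A -> barL (Bij A) = Bij A,
        forall A, Xi_ij r d A -> unitri (Xi_ij r d) A (Bij A)
      & Bij @` Xi_ij r d = (Bc @` Xi r d) `&` @schurL_ij r d L].
Proof.
have [[_ Bspan Bfree] Bbar Btri] := hBc.
have ijXi A : Xi_ij r d A -> Xi r d A by case.
have Btri_ij A : Xi_ij r d A -> unitri (Xi_ij r d) A (Bc A).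
  by move=> XA; apply: unitri_Xi_ij => //; apply/Btri/ijXi.
have B_ij A : Xi_ij r d A -> schurL_ij (Bc A).
  by move=> XA; apply: schurL_ij_unitri (Btri_ij _ XA).
have [F [FD FZ Ftens]] := bchange_corner r L.
have F0 : F 0 = 0 by have := FZ 0 0; rewrite !scale0r.
have Fsum (s : seq zmx) (x : zmx -> schurL r L) :
    F (\sum_(i <- s) x i) = \sum_(i <- s) F (x i).
  exact: (big_morph F FD F0).
have F_ij x : schurL_ij x -> F x = x.
  elim=> [|b _ y [f /schur_ij_corner fE ->] _ IH] //.
  by rewrite FD FZ Ftens fE IH.
have F_std A : Xi r d A -> ~ Xi_ij r d A -> F (stdL r L A) = 0.
  move=> XA nXA; rewrite /stdL Ftens corner_std // asboolF //.
  have := tensZ (specL L) 0 (0 : schurc r d).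
  by rewrite !scale0r raddf0 scale0r.
have F_B A : Xi r d A -> ~ Xi_ij r d A -> F (Bc A) = 0.
  move=> XA nXA; have [s [p [sX ->]]] := Btri A XA.
  rewrite FD F_std // add0r Fsum big_seq big1 // => b bs.
  have [Xb ba _] := sX b bs; rewrite FZ F_std ?scaler0 //.
  by move/(lt_alg_Xi_ij XA Xb ba).
(* F is the corner map: the identity on S^ij, and 0 on {A} if A is not in
   Xi^ij. *)
exists Bc; split=> [|A /ijXi|//|]; [|exact: Bbar|].
- split=> // [x xij|s c us sX]; last by apply: Bfree => // i /sX/ijXi.
  have [s [c [sX xE]]] := Bspan x I.
  exists [seq i <- s | `[< Xi_ij r d i >]], c; split=> [i|].
    by rewrite mem_filter => /andP[/asboolP].
  rewrite -(F_ij _ xij) xE Fsum big_filter [RHS]big_mkcond /=.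
  rewrite big_seq [RHS]big_seq.
  apply: eq_bigr => i si; rewrite FZ; case: asboolP => Xi_i.
    by rewrite F_ij //; apply: B_ij.
  by rewrite F_B ?scaler0 //; apply: sX.
- apply/seteqP; split=> [_ [A XA <-]|_ [[A XA <-] BA]].
    by split; [exists A; [apply: ijXi|]|apply: B_ij].
  exists A => //; apply: contrapT => nXA.
  have BA0 : Bc A = 0 by rewrite -(F_ij _ BA) F_B.
  suff /eqP : (1 : ringB) = 0 by rewrite oner_eq0.
  apply: (@Bfree [:: A] (fun=> 1) isT _ _ A (mem_head _ _)) => [i|].
    by rewrite inE => /eqP ->.
  by rewrite big_seq1 BA0 scaler0.
Qed.
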